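(* Let $R$ be a commutative ring with unity, let $M$ be an $R$-module, let $N$ be a nonzero Noetherian $R$-module, and let $F$ be an $R$-submodule of $\operatorname{Hom}_R(N,M)$. For every $\mathfrak p\in\operatorname{Ass}_R(N)$, suppose that $\operatorname{cog}^{F_{\mathfrak p}}_{R_{\mathfrak p}}(N_{\mathfrak p},M_{\mathfrak p})$ is finite, and let $t(\mathfrak p)$ be an integer with $t(\mathfrak p)\ge\operatorname{cog}^{F_{\mathfrak p}}_{R_{\mathfrak p}}(N_{\mathfrak p},M_{\mathfrak p})$. For every multiplicatively closed subset $S$ of $R$ with $S\cap\operatorname{Ann}_R(N)=\varnothing$, let $v(S):=\max\{t(\mathfrak p):\mathfrak p\in\operatorname{Ass}_R(N),\ \mathfrak p\cap S=\varnothing\}$. Also let $v:=v(\{1\})$. Then there exist $h_1,\dots,h_v\in F$ such that, for every multiplicatively closed subset $S$ of $R$ with $S\cap\operatorname{Ann}_R(N)=\varnothing$, the map $S^{-1}(h_1,\dots,h_{v(S)})^{\top}:S^{-1}N\to S^{-1}M^{\oplus v(S)}$ is injective. Hence $(h_1,\dots,h_v)^{\top}:N\to M^{\oplus v}$ is injective.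
   Context: Multiplicatively closed subsets contain $1$. $\operatorname{Ann}_R(N)$ is the annihilator of $N$ in $R$. For a prime $\mathfrak p$ of $R$, $\operatorname{Soc}_{R_{\mathfrak p}}(N_{\mathfrak p})$ is the set of elements of $N_{\mathfrak p}$ annihilated by $\mathfrak p_{\mathfrak p}=\mathfrak pR_{\mathfrak p}$, and $\operatorname{Ass}_R(N)$ is the (finite) set of primes $\mathfrak p$ of $R$ with $\operatorname{Soc}_{R_{\mathfrak p}}(N_{\mathfrak p})\neq 0$. For an integer $t\ge 0$, $F^{\oplus t}\subseteq\operatorname{Hom}_R(N,M^{\oplus t})$ denotes the set of maps given by columns $(f_1,\dots,f_t)^{\top}$, i.e. $x\mapsto(f_1(x),\dots,f_t(x))$, with all $f_j\in F$ (with $M^{\oplus 0}=0$). $\operatorname{cog}^F_R(N,M)$ (the global number of cogenerators of $N$ with respect to $M$ over $R$ when restricted to $F$) is the infimum of the integers $t\ge 0$ for which there is an injection in $F^{\oplus t}\subseteq\operatorname{Hom}_R(N,M^{\oplus t})$, with $\inf(\varnothing)=\infty$. For a prime $\mathfrak p$, $F_{\mathfrak p}$ is the localization of $F$ at $\mathfrak p$, viewed inside $\operatorname{Hom}_{R_{\mathfrak p}}(N_{\mathfrak p},M_{\mathfrak p})$ by letting $f/s$ act as $\frac1s f_{\mathfrak p}$, and $\operatorname{cog}^{F_{\mathfrak p}}_{R_{\mathfrak p}}(N_{\mathfrak p},M_{\mathfrak p})$ is defined in the same way over $R_{\mathfrak p}$ with $F_{\mathfrak p}$ in place of $F$. *)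

(* Defs.v *)
From HB Require Import structures.
From mathcomp Require Import all_boot all_order all_algebra ring.
From mathcomp Require Import boolp classical_sets functions cardinality fsbigop.
From mathcomp Require Import constructive_ereal.

Set Implicit Arguments.
Unset Strict Implicit.
Unset Printing Implicit Defensive.

Import Order.TTheory GRing.Theory Num.Theory.

Local Open Scope classical_set_scope.
Local Open Scope quotient_scope.
Local Open Scope ring_scope.

(** [mulrClosed R] is the library's type of multiplicatively closed subsets of
    [R] containing [1].  [locmod S N] is the module of fractions of [N] with
    denominators in [S]; the ring of fractions [locring S] is carried by
    [locmod S R^o]. *)

Section LocModule.
Variables (R : comPzRingType) (S : mulrClosed R) (N : lmodType R).

Definition denom := {s : R | s \in S}.
HB.instance Definition _ := Choice.on denom.

Definition denom1 : denom := exist _ 1 (rpred1 S).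
Definition denomM (s t : denom) : denom :=
  exist _ (sval s * sval t) (rpredM (svalP s) (svalP t)).

Definition loceq (x y : N * denom) : bool :=
  `[< exists2 u, u \in S & u *: (sval y.2 *: x.1) = u *: (sval x.2 *: y.1) >].

Lemma loceq_refl : reflexive loceq.
Proof. by move=> x; apply/asboolP; exists 1 => //; exact: rpred1. Qed.

Lemma loceq_sym : symmetric loceq.
Proof.
by move=> x y; apply/asboolP/asboolP => -[u Su e]; exists u; rewrite ?e.
Qed.

Lemma loceq_trans : transitive loceq.
Proof.
move=> y x z /asboolP[u Su e1] /asboolP[w Sw e2]; apply/asboolP.
exists (u * w * sval y.2); first by rewrite !rpredM ?(svalP y.2).
move: e1 e2; rewrite !scalerA => e1 e2.
transitivity ((w * sval z.2) *: ((u * sval y.2) *: x.1)).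
  by rewrite scalerA; congr (_ *: _); ring.
rewrite e1 scalerA.
transitivity ((u * sval x.2) *: ((w * sval z.2) *: y.1)).
  by rewrite scalerA; congr (_ *: _); ring.
by rewrite e2 scalerA; congr (_ *: _); ring.
Qed.

Canonical loceq_equiv := EquivRel loceq loceq_refl loceq_sym loceq_trans.

Definition locmod := {eq_quot loceq}.
HB.instance Definition _ : EqQuotient _ loceq locmod := EqQuotient.on locmod.
HB.instance Definition _ := Choice.on locmod.

Definition locfrac (x : N) (s : denom) : locmod := \pi_locmod (x, s).

Lemma locfrac_eq x s y t : locfrac x s = locfrac y t <->
  exists2 u, u \in S & u *: (sval t *: x) = u *: (sval s *: y).
Proof.
split=> [/eqmodP/asboolP //|h]; apply/eqmodP; exact/asboolP.
Qed.

Lemma locfrac_ext x s y t : sval t *: x = sval s *: y ->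
  locfrac x s = locfrac y t.
Proof. by move=> e; apply/locfrac_eq; exists 1; rewrite ?rpred1 ?e. Qed.

Lemma locfracW (P : locmod -> Prop) :
  (forall x s, P (locfrac x s)) -> forall z, P z.
Proof. by move=> h z; rewrite -[z]reprK; case: (repr z) => x s; exact: h. Qed.

Lemma locfrac_repr x s : exists2 u, u \in S &
  u *: (sval s *: (repr (locfrac x s)).1) =
  u *: (sval (repr (locfrac x s)).2 *: x).
Proof.
have : locfrac (repr (locfrac x s)).1 (repr (locfrac x s)).2 = locfrac x s.
  by rewrite /locfrac -surjective_pairing reprK.
by move/locfrac_eq.
Qed.

Definition loc0 : locmod := locfrac 0 denom1.
Definition locopp (z : locmod) : locmod :=
  locfrac (- (repr z).1) (repr z).2.
Definition locadd (z w : locmod) : locmod :=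
  locfrac (sval (repr w).2 *: (repr z).1 + sval (repr z).2 *: (repr w).1)
          (denomM (repr z).2 (repr w).2).

Lemma locoppE x s : locopp (locfrac x s) = locfrac (- x) s.
Proof.
rewrite /locopp; case: (locfrac_repr x s); case: (repr _) => [y t] /= u Su e.
by apply/locfrac_eq; exists u => //; rewrite !scalerN e.
Qed.

Lemma locaddE x s y t : locadd (locfrac x s) (locfrac y t) =
  locfrac (sval t *: x + sval s *: y) (denomM s t).
Proof.
rewrite /locadd; case: (locfrac_repr x s); case: (repr _) => [x' s'] /= u Su e.
case: (locfrac_repr y t); case: (repr _) => [y' t'] /= w Sw f.
apply/locfrac_eq; exists (u * w); first by rewrite rpredM.
move: e f; rewrite /= !scalerA !scalerDr !scalerA => e f; congr (_ + _).
  transitivity ((w * sval t * sval t') *: ((u * sval s) *: x')).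
    by rewrite scalerA; congr (_ *: _); ring.
  by rewrite e scalerA; congr (_ *: _); ring.
transitivity ((u * sval s * sval s') *: ((w * sval t) *: y')).
  by rewrite scalerA; congr (_ *: _); ring.
by rewrite f scalerA; congr (_ *: _); ring.
Qed.

Fact locaddA : associative locadd.
Proof.
elim/locfracW=> x s; elim/locfracW=> y t; elim/locfracW=> z r.
rewrite !locaddE; apply: locfrac_ext; rewrite /= !scalerDr !scalerA addrA.
by congr (_ *: _ + _ *: _ + _ *: _); ring.
Qed.

Fact locaddC : commutative locadd.
Proof.
elim/locfracW=> x s; elim/locfracW=> y t.
rewrite !locaddE; apply: locfrac_ext; rewrite /= addrC.
by congr (_ *: _); ring.
Qed.

Fact locadd0 : left_id loc0 locadd.
Proof.
elim/locfracW=> x s; rewrite locaddE; apply: locfrac_ext.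
by rewrite /= scaler0 add0r scale1r mul1r.
Qed.

Fact locaddN : left_inverse loc0 locopp locadd.
Proof.
elim/locfracW=> x s; rewrite locoppE locaddE; apply: locfrac_ext.
by rewrite /= scalerN addNr !scaler0.
Qed.

HB.instance Definition _ :=
  GRing.isZmodule.Build locmod locaddA locaddC locadd0 locaddN.

Lemma locfracD x s y t : locfrac x s + locfrac y t =
  locfrac (sval t *: x + sval s *: y) (denomM s t).
Proof. exact: locaddE. Qed.

End LocModule.

Section LocRing.
Variables (R : comPzRingType) (S : mulrClosed R).

Definition locring : Type := locmod S R^o.
HB.instance Definition _ := GRing.Zmodule.on locring.

Definition rfrac (a : R) (s : denom S) : locring := locfrac (a : R^o) s.

Lemma rfrac_ext a s b t : sval t * a = sval s * b -> rfrac a s = rfrac b t.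
Proof. by move=> e; apply: locfrac_ext. Qed.

Lemma rfracW (P : locring -> Prop) :
  (forall a s, P (rfrac a s)) -> forall z, P z.
Proof. by move=> h z; elim/(@locfracW R S R^o): z. Qed.

Lemma rfracD a s b t :
  rfrac a s + rfrac b t = rfrac (sval t * a + sval s * b) (denomM s t).
Proof. exact: locfracD. Qed.

Lemma rfrac_repr a s : exists2 u, u \in S &
  u * (sval s * (repr (rfrac a s)).1) = u * (sval (repr (rfrac a s)).2 * a).
Proof. exact: (@locfrac_repr R S R^o). Qed.

Section Scale.
Variable N : lmodType R.

(** $(a/s)\cdot(x/t) = ax/(st)$ *)
Definition locscale (z : locring) (w : locmod S N) : locmod S N :=
  locfrac (((repr z).1 : R) *: (repr w).1) (denomM (repr z).2 (repr w).2).

Lemma locscaleE a s x t :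
  locscale (rfrac a s) (locfrac x t) = locfrac (a *: x) (denomM s t).
Proof.
rewrite /locscale; case: (rfrac_repr a s); case: (repr _) => [a' s'] /= u Su e.
case: (locfrac_repr x t); case: (repr _) => [x' t'] /= w Sw f.
apply/locfrac_eq; exists (u * w); first by rewrite rpredM.
move: f; rewrite /= !scalerA => f.
transitivity ((u * (sval s * a')) *: ((w * sval t) *: x')).
  by rewrite scalerA; congr (_ *: _); ring.
by rewrite e f scalerA; congr (_ *: _); ring.
Qed.

End Scale.

Definition loc1 : locring := rfrac 1 (denom1 S).
Definition locmul (z w : locring) : locring := locscale z (w : locmod S R^o).

Lemma locmulE a s b t :
  locmul (rfrac a s) (rfrac b t) = rfrac (a * b) (denomM s t).
Proof. exact: locscaleE. Qed.

Fact locmulA : associative locmul.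
Proof.
elim/rfracW=> x s; elim/rfracW=> y t; elim/rfracW=> z r.
by rewrite !locmulE; apply: rfrac_ext => /=; ring.
Qed.

Fact locmulC : commutative locmul.
Proof.
elim/rfracW=> x s; elim/rfracW=> y t.
by rewrite !locmulE; apply: rfrac_ext => /=; ring.
Qed.

Fact locmul1 : left_id loc1 locmul.
Proof.
by elim/rfracW=> x s; rewrite !locmulE; apply: rfrac_ext => /=; ring.
Qed.

Fact locmulDl : left_distributive locmul +%R.
Proof.
elim/rfracW=> x s; elim/rfracW=> y t; elim/rfracW=> z r.
by rewrite rfracD !locmulE rfracD; apply: rfrac_ext => /=; ring.
Qed.

HB.instance Definition _ :=
  GRing.Zmodule_isComPzRing.Build locring locmulA locmulC locmul1 locmulDl.

Lemma rfracM a s b t : rfrac a s * rfrac b t = rfrac (a * b) (denomM s t).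
Proof. exact: locmulE. Qed.

Section LocLmodule.
Variable N : lmodType R.

Fact locscaleA (a b : locring) (v : locmod S N) :
  locscale a (locscale b v) = locscale (a * b) v.
Proof.
elim/rfracW: a => x s; elim/rfracW: b => y t; elim/locfracW: v => z r.
rewrite rfracM !locscaleE; apply: locfrac_ext; rewrite /= !scalerA.
by congr (_ *: _); ring.
Qed.

Fact locscale1 : left_id (1 : locring) (@locscale N).
Proof.
elim/locfracW=> z r; rewrite locscaleE; apply: locfrac_ext.
by rewrite /= !scalerA; congr (_ *: _); ring.
Qed.

Fact locscaleDr : right_distributive (@locscale N) +%R.
Proof.
elim/rfracW=> x s; elim/locfracW=> y t; elim/locfracW=> z r.
rewrite !(locscaleE, locfracD); apply: locfrac_ext.
by rewrite /= !scalerDr !scalerA; congr (_ *: _ + _ *: _); ring.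
Qed.

Fact locscaleDl (v : locmod S N) : {morph (@locscale N)^~ v : a b / a + b}.
Proof.
elim/rfracW=> x s; elim/rfracW=> y t; elim/locfracW: v => z r.
rewrite rfracD !locscaleE locfracD; apply: locfrac_ext.
rewrite /= !(scalerDl, scalerDr) !scalerA.
by congr (_ *: _ + _ *: _); ring.
Qed.

HB.instance Definition _ := GRing.Zmodule_isLmodule.Build locring (locmod S N)
  locscaleA locscale1 locscaleDr locscaleDl.

Lemma locfracZ a s x t :
  rfrac a s *: locfrac x t = locfrac (a *: x) (denomM s t).
Proof. exact: locscaleE. Qed.

End LocLmodule.
End LocRing.

Section LocMap.
Variables (R : comPzRingType) (S : mulrClosed R) (N M : lmodType R).
Variable f : {linear N -> M}.

Definition locmap (z : locmod S N) : locmod S M :=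
  locfrac (f (repr z).1) (repr z).2.

Lemma locmapE x s : locmap (locfrac x s) = locfrac (f x) s.
Proof.
rewrite /locmap; case: (locfrac_repr x s); case: (repr _) => [y t] /= u Su e.
apply/locfrac_eq; exists u => //.
by have := congr1 f e; rewrite !(linearZ_LR f).
Qed.

Fact locmap_is_linear : linear_for ( *:%R : locring S -> _) locmap.
Proof.
elim/rfracW=> a s; elim/locfracW=> x t; elim/locfracW=> y r.
rewrite locfracZ locfracD !locmapE locfracZ locfracD; apply: locfrac_ext.
by rewrite /= (linearD f) !(linearZ_LR f).
Qed.

HB.instance Definition _ :=
  GRing.isLinear.Build (locring S) (locmod S N) (locmod S M) _ locmap
    locmap_is_linear.

End LocMap.
Arguments locmap {R} S {N M} f.

Section Columns.
Variables (R : comPzRingType) (N M : lmodType R) (t : nat).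
Variable f : 'I_t -> {linear N -> M}.

Definition colmap (x : N) : {ffun 'I_t -> M} := [ffun j => f j x].

Fact colmap_is_linear : linear colmap.
Proof. by move=> a x y; apply/ffunP => j; rewrite !ffunE linearP. Qed.

HB.instance Definition _ :=
  GRing.isLinear.Build R N {ffun 'I_t -> M} _ colmap colmap_is_linear.

End Columns.

Definition noetherian (R : comPzRingType) (N : lmodType R) : Prop :=
  forall U : {pred N}, submod_closed U ->
    exists s : seq N, forall x, x \in U <->
      exists c : 'I_(size s) -> R, x = \sum_i c i *: s`_i.

Definition annihilator (R : comPzRingType) (N : lmodType R) : set R :=
  [set a | forall x : N, a *: x = 0].

Definition hom_submodule (R : comPzRingType) (N M : lmodType R)
    (F : set {linear N -> M}) : Prop :=
  F \0 /\ forall (a : R) (f g : {linear N -> M}),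
            F f -> F g -> F (a \*: f \+ g).

(** The infimum in $\mathbb{N}\cup\{\infty\}$, with $\inf\varnothing=\infty$. *)
Definition enat_inf (A : set nat) : \bar int :=
  if pselect (exists t, `[< A t >]) is left e then (ex_minn e)%:Z%:E else +oo%E.

Definition cog (R : comPzRingType) (N M : lmodType R)
    (F : set {linear N -> M}) : \bar int :=
  enat_inf [set t | exists f : 'I_t -> {linear N -> M},
                      (forall j, F (f j)) /\ injective (colmap f)].

(** $S^{-1}F$, viewed inside $\mathrm{Hom}_{S^{-1}R}(S^{-1}N, S^{-1}M)$. *)
Definition lochom (R : comPzRingType) (S : mulrClosed R) (N M : lmodType R)
    (F : set {linear N -> M}) : set {linear locmod S N -> locmod S M} :=
  [set g | exists f s, F f /\ forall z, g z = rfrac 1 s *: locmap S f z].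
Arguments lochom {R} S {N M} F _.

Record primeIdeal (R : comPzRingType) := PrimeIdeal {
  prime_pred :> R -> bool;
  prime_submod : submod_closed (prime_pred : {pred R^o});
  prime_proper : 1 \notin prime_pred;
  prime_mul : forall a b, a * b \in prime_pred ->
                (a \in prime_pred) || (b \in prime_pred) }.

Canonical primeIdeal_predType (R : comPzRingType) :=
  PredType (@prime_pred R).

HB.instance Definition _ (R : comPzRingType) := gen_eqMixin (primeIdeal R).
HB.instance Definition _ (R : comPzRingType) := gen_choiceMixin (primeIdeal R).

Section Primes.
Variables (R : comPzRingType) (p : primeIdeal R).

Definition primeC_pred : {pred R} := [pred a | a \notin p].

Fact primeC_mulr_closed : mulr_closed primeC_pred.
Proof.
split=> [|a b]; first exact: prime_proper.
by rewrite !inE => pa pb; apply/negP => /prime_mul; rewrite (negPf pa) (negPf pb).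
Qed.

HB.instance Definition _ :=
  GRing.isMulClosed.Build R primeC_pred primeC_mulr_closed.

Definition primeC : mulrClosed R := primeC_pred.

(** The ideal $\mathfrak{p}R_{\mathfrak{p}}$ of $R_{\mathfrak{p}}$. *)
Definition locprime : set (locring primeC) :=
  [set z | exists a s, a \in p /\ z = rfrac a s].

Definition Soc (N : lmodType R) : set (locmod primeC N) :=
  [set z | forall a, locprime a -> a *: z = 0].

End Primes.
Arguments locprime {R} p _.
Arguments Soc {R} p N _.

Definition Ass (R : comPzRingType) (N : lmodType R) : set (primeIdeal R) :=
  [set p | exists2 z, Soc p N z & z != 0].
Arguments Ass {R} N _.

(** The big operator is finitely supported: it is the maximum over the primes
    with [t p != 0] when these are finitely many, and [0] otherwise.  When [N]
    is Noetherian, [Ass N] is finite and the second case does not arise. *)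

Section MaxAss.
Variables (R : comPzRingType) (N : lmodType R) (t : primeIdeal R -> nat).

Definition max_ass (S : mulrClosed R) : nat :=
  \big[maxn/0%N]_(p \in [set p | Ass N p /\ forall a, a \in p -> a \notin S]) t p.

End MaxAss.
Arguments max_ass {R} N t S.

Section One.
Variable R : comPzRingType.

Definition mul_one_pred : {pred R} := pred1 1.

Fact mul_one_mulr_closed : mulr_closed mul_one_pred.
Proof.
split=> [|a b]; rewrite !inE => //.
by move=> /eqP-> /eqP->; rewrite mul1r.
Qed.

HB.instance Definition _ :=
  GRing.isMulClosed.Build R mul_one_pred mul_one_mulr_closed.

Definition mul_one : mulrClosed R := mul_one_pred.

End One.
Arguments mul_one {R}.

(* Main.v *)
(** An element killed by no element of [S] has a multiple whose annihilator is
    an associated prime of [N] disjoint from [S].  So it suffices that, for every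
    associated prime [p], the maps [h_i] with [i < t p] have no common zero among
    the elements of [N] with annihilator [p].  There are finitely many such
    primes, and the maps are corrected at one prime after the other, the minimal
    ones last: the corrections at [p] are multiples of an [a] that lies in the
    primes already treated but not in [p].  At [p], the columns given by the
    local number of cogenerators are exchanged one at a time for columns
    [h_i + a e_i]: a suitable [e_i] exists because a pencil [h + c g] with [g]
    injective has only finitely many singular members over the residue field. *)

Require Import Defs.
From mathcomp Require Import all_boot all_order all_algebra ring.
From mathcomp Require Import boolp classical_sets functions cardinality fsbigop.
From mathcomp Require Import constructive_ereal.

Set Implicit Arguments.
Unset Strict Implicit.
Unset Printing Implicit Defensive.

Import Order.TTheory GRing.Theory Num.Theory.

Local Open Scope classical_set_scope.
Local Open Scope ring_scope.

Lemma scalerC (R : comPzRingType) (N : lmodType R) (a b : R) (x : N) :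
  a *: (b *: x) = b *: (a *: x).
Proof. by rewrite !scalerA mulrC. Qed.

(** * Finite generation, chains and maximal submodules *)

Section Noetherian.
Variables (R : comPzRingType) (N : lmodType R).
Hypothesis N_noeth : noetherian N.

Lemma submod_sum (U : {pred N}) (n : nat) (c : nat -> R) (x : nat -> N) :
  submod_closed U -> (forall i, (i < n)%N -> x i \in U) ->
  \sum_(i < n) c i *: x i \in U.
Proof.
case=> U0 Ulin; elim: n => [|n IHn] xU; first by rewrite big_ord0.
rewrite big_ord_recr /= addrC; apply: Ulin; first exact: xU.
by apply: IHn => i /ltnW; exact: xU.
Qed.

(** The spans of the initial segments form a chain whose union is a submodule; its finitely many
    generators already lie in one of these spans. *)
Lemma noetherian_seq (x : nat -> N) :
  exists n, exists c : nat -> R, x n = \sum_(i < n) c i *: x i.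
Proof.
pose span n y := exists c : nat -> R, y = \sum_(i < n) c i *: x i.
have span0 n : span n 0.
  by exists (fun=> 0); rewrite big1 // => i _; rewrite scale0r.
have spanP n a u w : span n u -> span n w -> span n (a *: u + w).
  move=> [c ->] [d ->]; exists (fun i => a * c i + d i).
  rewrite scaler_sumr -big_split /=; apply: eq_bigr => i _.
  by rewrite scalerDl scalerA.
have spanW m n y : (m <= n)%N -> span m y -> span n y.
  move=> mn [c ->]; exists (fun i => if (i < m)%N then c i else 0).
  rewrite (big_ord_widen n (fun i => c i *: x i) mn) big_mkcond /=.
  by apply: eq_bigr => i _; case: ifP; rewrite ?scale0r.
have [|s sP] := @N_noeth [pred y | `[< exists n, span n y >]].
  split=> [|a u w]; rewrite !inE; first by exists 0%N.
  move=> [m um] [n wn].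
  exists (maxn m n); apply: spanP.
    by apply: spanW um; exact: leq_maxl.
  by apply: spanW wn; exact: leq_maxr.
have [n sn] : exists n, forall i : 'I_(size s), span n s`_i.
  have /choice[m mP] (i : 'I_(size s)) : exists n, span n s`_i.
    suff : s`_i \in [pred y | `[< exists n, span n y >]].
      by rewrite inE .
    apply/sP; exists (fun j => (j == i)%:R).
    rewrite (bigD1 i) //= eqxx scale1r big1 ?addr0 // => j /negPf ->.
    by rewrite scale0r.
  exists (\max_i m i)%N => i; apply: spanW (mP i); exact: leq_bigmax.
exists n; suff : span n (x n) by [].
have /sP[c ->] : x n \in [pred y | `[< exists n, span n y >]].
  rewrite inE; exists n.+1, (fun i => (i == n)%:R).
  rewrite big_ord_recr /= eqxx scale1r big1 ?add0r // => i _.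
  by rewrite ltn_eqF ?scale0r.
by elim/big_rec: _ => [|i y _ yn]; [exact: span0 | exact: spanP].
Qed.

(** Without a maximal member, dependent choice gives a strictly ascending chain; elements picked
    from the successive differences contradict [noetherian_seq]. *)
Lemma noetherian_max (P : {pred N} -> Prop) (U0 : {pred N}) :
  submod_closed U0 -> P U0 ->
  exists U, [/\ submod_closed U, P U &
    forall V, submod_closed V -> P V -> {subset U <= V} -> {subset V <= U}].
Proof.
move=> U0s PU0; apply: contrapT => noU.
pose X := {U : {pred N} | submod_closed U /\ P U}.
pose lt (U V : X) := {subset sval U <= sval V} /\
  exists2 y, y \in sval V & y \notin sval U.
have step (U : X) : {V : X | lt U V}.
  apply: cid; apply: contrapT => noV; apply: noU; exists (sval U).
  case: (svalP U) => Us PU; split=> // V Vs PV UV y yV; apply: contrapT => yU.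
  by apply: noV; exists (exist _ V (conj Vs PV)); split=> //; exists y => //;
    exact/negP.
have [f [_ fP]] := dependent_choice step (exist _ U0 (conj U0s PU0)).
have /choice[x xP] n : exists y, y \in sval (f n.+1) /\ y \notin sval (f n).
  by have [_ [y ? ?]] := fP n; exists y.
have fmono m n : (m <= n)%N -> {subset sval (f m) <= sval (f n)}.
  elim: n => [|n IHn]; first by rewrite leqn0 => /eqP->.
  rewrite leq_eqVlt => /predU1P[-> //|/IHn mn] y /mn.
  by have [fn _] := fP n; exact: fn.
have [n [c xn]] := noetherian_seq x.
have [_ /negP[]] := xP n; rewrite xn; apply: submod_sum.
  by have [] := svalP (f n).
by move=> i ltin; apply: (fmono i.+1) => //; have [] := xP i.
Qed.

End Noetherian.

(** * Prime ideals: minimal members of a list, and avoidance *)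

Section PrimeIdeals.
Variable R : comPzRingType.
Implicit Types p q : primeIdeal R.

Lemma prime0 p : 0 \in p.
Proof. by have [] := prime_submod p. Qed.

Lemma prime_lin p a b c : b \in p -> c \in p -> a * b + c \in p.
Proof. by have [_] := prime_submod p; exact. Qed.

Lemma primeMl p a b : b \in p -> a * b \in p.
Proof. by move=> bp; rewrite -[a * b]addr0 prime_lin ?prime0. Qed.

Lemma primeNr p a : (- a \in p) = (a \in p).
Proof.
apply/idP/idP => /(primeMl (-1)); first by rewrite mulN1r opprK.
by rewrite mulN1r.
Qed.

Lemma primeM p a b : (a * b \in p) = (a \in p) || (b \in p).
Proof.
apply/idP/orP => [/prime_mul/orP //|[ap|bp]]; last exact: primeMl.
by rewrite mulrC primeMl.
Qed.

Lemma primeX p a n : a \notin p -> a ^+ n \notin p.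
Proof.
move=> ap; elim: n => [|n IHn]; first by rewrite expr0 prime_proper.
by rewrite exprS primeM negb_or ap.
Qed.

Lemma primeIdeal_eq p q : p =i q -> p = q.
Proof.
case: p => p1 p2 p3 p4; case: q => q1 q2 q3 q4 eqpq.
have epq : p1 = q1 by apply/funext => a; exact: eqpq.
move: p2 p3 p4 eqpq; rewrite epq => p2 p3 p4 _.
by congr PrimeIdeal; exact: Prop_irrelevance.
Qed.

Lemma minimal_prime (s : seq (primeIdeal R)) : s != [::] ->
  exists2 p, p \in s & forall q, q \in s -> {subset q <= p} -> q = p.
Proof.
elim: s => [//|x [_ _|y s] ].
  by exists x; rewrite ?mem_head // => q; rewrite inE => /eqP.
set s' := y :: s => /(_ isT)[p ps pmin] _.
have [xp|xp] := pselect ({subset x <= p} /\ x <> p); last first.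
  exists p; first by rewrite inE ps orbT.
  move=> q; rewrite inE => /predU1P[->|]; last exact: pmin.
  by move=> sxp; apply: contrapT => nxp; apply: xp.
exists x; first exact: mem_head.
move=> q; rewrite inE => /predU1P[//|qs qx].
have qp : q = p by apply: pmin qs _ => a /qx; have [+ _] := xp; exact.
case: xp => xp []; apply: primeIdeal_eq => a; apply/idP/idP; first exact: xp.
by rewrite -qp; exact: qx.
Qed.

(** Take one element outside [p] from each listed prime; their product stays outside [p] by
    primality. *)
Lemma prime_avoid p (s : seq (primeIdeal R)) :
  (forall q, q \in s -> ~ {subset q <= p}) ->
  exists2 a, a \notin p & forall q, q \in s -> a \in q.
Proof.
elim: s => [_|q s IHs sp]; first by exists 1; rewrite ?prime_proper.
have [r rs|a ap aq] := IHs; first by apply: sp; rewrite inE rs orbT.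
have [b bq bp] : exists2 b, b \in q & b \notin p.
  apply: contrapT => nob; apply: (sp q); first exact: mem_head.
  by move=> b bq; apply: contrapT => /negP bp; apply: nob; exists b.
exists (a * b); first by rewrite primeM negb_or ap.
by move=> r; rewrite inE primeM => /predU1P[->|/aq ->]; rewrite ?bq ?orbT.
Qed.

End PrimeIdeals.

(** * Associated primes as annihilators of elements *)

Definition ann_eq (R : comPzRingType) (N : lmodType R) (p : primeIdeal R)
  (y : N) := forall a, (a *: y == 0) = (a \in p).

Lemma ann_eqN (R : comPzRingType) (N : lmodType R) (p : primeIdeal R) (y : N) :
  (forall a, a \in p -> a *: y = 0) -> ~ ann_eq p y ->
  exists2 u, u \notin p & u *: y = 0.
Proof.
move=> py nann; apply: contrapT => nou; apply: nann => a.
apply/eqP/idP => [ay|]; last exact: py.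
by apply: contrapT => /negP ap; apply: nou; exists a.
Qed.

Section AssociatedPrimes.
Variables (R : comPzRingType) (N : lmodType R).
Hypothesis N_noeth : noetherian N.

(** Among the multiples of [x] killed by no element of [S], one with maximal annihilator has a prime
    annihilator. As only [N] is Noetherian, the annihilator of [a *: x] is replaced by its image
    [I a] under [b |-> b *: x]. *)
Lemma exists_ann_eq (S : mulrClosed R) (x : N) :
  (forall s, s \in S -> s *: x != 0) ->
  exists p a, @ann_eq R N p (a *: x) /\ forall b, b \in p -> b \notin S.
Proof.
move=> Sx.
pose I (a : R) :=
  [pred y : N | `[< exists2 b, y = b *: x & b *: (a *: x) = 0 >]].
have Is a : submod_closed (I a).
  split=> [|c u w]; rewrite !inE.
    by exists 0; rewrite scale0r.
  move=> [b -> bx] [d -> dx].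
  exists (c * b + d); first by rewrite scalerDl scalerA.
  by rewrite scalerDl -scalerA bx dx scaler0 addr0.
pose P (U : {pred N}) := exists2 a, U = I a &
  forall s, s \in S -> s *: (a *: x) != 0.
have P1 : P (I 1) by exists 1 => // s /Sx; rewrite scale1r.
have [U [_ [a -> Sa] Umax]] := noetherian_max N_noeth (Is 1) P1.
have maxa c b : (forall s, s \in S -> s *: ((c * a) *: x) != 0) ->
    b *: ((c * a) *: x) = 0 -> b *: (a *: x) = 0.
  move=> Sca bca.
  have sub : {subset I a <= I (c * a)}.
    move=> y; rewrite !inE => -[d -> da]; exists d => //.
    by rewrite -scalerA (scalerC d) da scaler0.
  have : b *: x \in I a.
    by apply: (Umax _ (Is _) _ sub); [exists (c * a) | rewrite inE; exists b].
  rewrite inE => -[d bd dx].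
  by rewrite (scalerC b) bd scalerC.
pose y := a *: x; pose p := [pred b : R | b *: y == 0].
have p_submod : submod_closed (p : {pred R^o}).
  split=> [|c u w]; rewrite !inE ?scale0r // => /eqP uy /eqP wy.
  by rewrite scalerDl -scalerA uy wy scaler0 addr0.
have p_proper : 1 \notin p by rewrite inE; apply: Sa; exact: rpred1.
have p_mul b c : b * c \in p -> (b \in p) || (c \in p).
  rewrite !inE => /eqP bcy; apply/orP.
  have [|cy] := pselect (c *: y = 0); first by move/eqP; right.
  left; apply/eqP; apply: (maxa c); last first.
    by rewrite -scalerA scalerA.
  (* If [s] kills [c *: y], then [c] kills [s *: y], and maximality applied to the multiple [s * a]
     gives [c *: y = 0]. *)
  move=> s sS; apply/eqP => scy; apply: cy.
  apply: (maxa s) => [r rS|]; last first.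
    by rewrite -scalerA (scalerC c) [c *: _]scalerA.
  by rewrite -scalerA scalerA; apply: Sa; exact: rpredM.
exists (PrimeIdeal p_submod p_proper p_mul), a; split=> // b bp.
by apply/negP => /Sa; move: bp; rewrite /in_mem /= => ->.
Qed.

(** Noetherian induction on the statement for [N / U]: if [y] has annihilator
    [p] modulo [U], then an associated prime of [N / U] other than [p] is one of
    [N / (U + R y)]. *)
Lemma finite_ann_eq : finite_set [set p | exists y : N, ann_eq p y].
Proof.
pose A (U : {pred N}) := [set p : primeIdeal R | exists y,
  forall a, (a *: y \in U) = (a \in p)].
suff : finite_set (A (pred1 0)) by [].
apply: contrapT => infA.
have s0 : submod_closed (pred1 (0 : N)).
  by split=> [|c u w]; rewrite !inE // => /eqP-> /eqP->; rewrite scaler0 addr0.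
have [U [Us infU Umax]] :=
  noetherian_max (P := fun U => ~ finite_set (A U)) N_noeth s0 infA.
have [U0 Ulin] := Us.
apply: infU; have [Ap|noA] := pselect (exists p, A U p); last first.
  by apply: (@sub_finite_set _ _ set0) => // p Ap; apply: noA; exists p.
have [p [y yp]] := Ap.
pose V := [pred z : N | `[< exists u b, u \in U /\ z = u + b *: y >]].
have Vs : submod_closed V.
  split=> [|c z w]; rewrite !inE.
    by exists 0, 0; rewrite scale0r addr0.
  move=> [u [b [uU ->]]] [u' [b' [u'U ->]]].
  exists (c *: u + u'), (c * b + b'); split; first exact: Ulin.
  by rewrite scalerDr scalerDl scalerA addrACA.
have UV : {subset U <= V}.
  by move=> u uU; rewrite inE; exists u, 0; rewrite scale0r addr0.
have finV : finite_set (A V).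
  apply: contrapT => infV; have /(_ y) := Umax V Vs infV UV.
  rewrite inE -[X in X \in U]scale1r yp => yV.
  have /negP[] := prime_proper p; apply: yV.
  by exists 0, 1; rewrite add0r scale1r.
apply: (@sub_finite_set _ _ (A V `|` [set p])); last first.
  by rewrite finite_setU; split=> //; exact: finite_set1.
move=> q [z zq]; have [qV|nqV] := pselect (A V q); [by left|right].
have [a aq aV] : exists2 a, a \notin q & a *: z \in V.
  apply: contrapT => noa; apply: nqV; exists z => a; apply/idP/idP => [aV|].
    by apply: contrapT => /negP aq; apply: noa; exists a.
  by rewrite -zq => /UV.
move: aV; rewrite inE => -[u [b [uU azE]]].
have subU w : (u + w \in U) = (w \in U).
  apply/idP/idP => wU; last by rewrite -[u]scale1r Ulin.
  have -> : w = -1 *: u + (u + w) by rewrite scaleN1r addKr.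
  exact: Ulin.
have nU : b *: y \notin U.
  by rewrite -subU -azE zq.
(* Modulo [U], the elements [a *: z] and [b *: y] agree and are nonzero; the first has annihilator
   [q], the second [p]. *)
apply: primeIdeal_eq => c.
have -> : (c \in q) = (c *: (a *: z) \in U).
  by rewrite scalerA zq primeM (negPf aq) orbF.
rewrite azE scalerDr.
have -> : (c *: u + c *: (b *: y) \in U) = (c *: (b *: y) \in U).
  have cuU : c *: u \in U by rewrite -[_ *: u]addr0 Ulin.
  apply/idP/idP => wU; last by rewrite -[c *: u]scale1r Ulin.
  have -> : c *: (b *: y) = -1 *: (c *: u) + (c *: u + c *: (b *: y)).
    by rewrite scaleN1r addKr.
  exact: Ulin.
by rewrite scalerA yp primeM; move: nU; rewrite yp => /negPf->; rewrite orbF.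
Qed.

(** Let [x] be the numerator of a nonzero socle element. Each element of [p x] is killed by some
    element outside [p]; as [p x] is finitely generated, a single [u] kills all of it, and [u *: x]
    has annihilator [p]. *)
Lemma AssP (p : primeIdeal R) : Ass N p <-> exists y : N, ann_eq p y.
Proof.
split=> [[]|[y yp]]; last first.
  exists (locfrac y (denom1 (primeC p))).
    move=> _ [a [s [ap ->]]]; rewrite locfracZ; apply/locfrac_eq.
    exists 1; rewrite ?rpred1 //=.
    by move/eqP: (yp a); rewrite ap => ->; rewrite !scaler0.
  apply/eqP => /locfrac_eq[u up] /=; rewrite !scale1r scaler0 => /eqP.
  by rewrite yp; apply/negP.
elim/locfracW=> x s soc nz.
have px a : a \in p -> exists2 u, u \notin p & u *: (a *: x) = 0.
  move=> ap; have : locprime p (rfrac a (denom1 _)) by exists a, (denom1 _).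
  move=> /soc; rewrite locfracZ => /locfrac_eq[u up] /=.
  by rewrite !scale1r !scaler0; exists u.
have [|t tP] := @N_noeth [pred y | `[< exists2 a, a \in p & y = a *: x >]].
  split=> [|c u w]; rewrite !inE.
    by exists 0; rewrite ?prime0 ?scale0r.
  move=> [a ap ->] [b bp ->].
  by exists (c * a + b); rewrite ?prime_lin // scalerDl scalerA.
have [u up ut] : exists2 u, u \notin p & forall i : 'I_(size t), u *: t`_i = 0.
  have : forall y, y \in t -> exists2 u, u \notin p & u *: y = 0.
    move=> y yt; have : y \in [pred y | `[< exists2 a, a \in p & y = a *: x >]].
      apply/tP; have iy : (index y t < size t)%N by rewrite index_mem.
      exists (fun j => (j == Ordinal iy)%:R).
      rewrite (bigD1 (Ordinal iy)) //= eqxx scale1r nth_index // big1 ?addr0 //.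
      by move=> j /negPf ->; rewrite scale0r.
    by rewrite inE => -[a ap ->]; exact: px.
  elim: (t) => [_|y r IHr yr]; first by exists 1; [exact: prime_proper | case].
  have [z zr|u up ur] := IHr; first by apply: yr; rewrite inE zr orbT.
  have [w wp wy] := yr y (mem_head _ _).
  exists (u * w); first by rewrite primeM negb_or up.
  case=> -[|i] ir /=; first by rewrite -scalerA wy scaler0.
  by rewrite mulrC -scalerA (ur (Ordinal (ir : (i < size r)%N))) scaler0.
exists (u *: x); apply: contrapT => nann; have [|w wp wux] := ann_eqN _ nann.
  move=> a ap; rewrite scalerC.
  have /tP[c ->] : a *: x \in [pred y | `[< exists2 a, a \in p & y = a *: x >]].
    by rewrite inE; exists a.
  by rewrite scaler_sumr big1 // => i _; rewrite scalerC ut scaler0.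
move/eqP: nz; apply; apply/locfrac_eq; exists (w * u).
  by rewrite inE primeM negb_or wp.
by rewrite /= scale1r !scaler0 -scalerA.
Qed.

End AssociatedPrimes.

(** * Correcting the columns at one prime by multiples of [a] *)

Section Perturbation.
Variables (R : comPzRingType) (N M : lmodType R) (p : primeIdeal R).
Hypothesis N_noeth : noetherian N.

(** Eigenvectors of the pencil [h + c g] for distinct [c] modulo [p] are
    independent modulo [p], and [N] has no infinite independent sequence. *)
Lemma pencil_injective (K : {pred N}) (g h : {linear N -> M})
    (lam : nat -> R) :
  submod_closed K -> (forall y a, y \in K -> a \in p -> a *: y = 0) ->
  (forall y, y \in K -> ann_eq p y -> g y != 0) ->
  (forall i j, (i < j)%N -> lam j - lam i \notin p) ->
  exists n, forall y, y \in K -> ann_eq p y -> h y + lam n *: g y != 0.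
Proof.
move=> Ks Kp gK lamP; apply: contrapT => nolam.
have /choice[x xP] n : exists y, [/\ y \in K, ann_eq p y &
    h y + lam n *: g y = 0].
  apply: contrapT => noy; apply: nolam; exists n => y yK yp.
  by apply/eqP => hy; apply: noy; exists y.
have indep n (c : nat -> R) : \sum_(i < n) c i *: x i = 0 ->
    forall i, (i < n)%N -> c i \in p.
  elim: n c => [//|n IHn] c cx.
  (* Since [h] acts on [x i] as [- lam i *: g], applying [h + lam n *: g] to the relation gives
     [g z = 0], and the coefficient of [x n] drops out. *)
  pose d i := c i * (lam n - lam i).
  pose z := \sum_(i < n) d i *: x i.
  have zE : z = \sum_(i < n.+1) d i *: x i.
    by rewrite big_ord_recr /= {2}/d subrr mulr0 scale0r addr0.
  have zK : z \in K by apply: submod_sum => // i _; have [] := xP i.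
  have gz : g z = 0.
    transitivity (lam n *: g (\sum_(i < n.+1) c i *: x i) +
        h (\sum_(i < n.+1) c i *: x i)); last by rewrite cx !linear0 addr0.
    rewrite zE !linear_sum -big_split /=; apply: eq_bigr => i _.
    have [_ _ /eqP] := xP i; rewrite addr_eq0 => /eqP hx.
    rewrite !(linearZ_LR g) (linearZ_LR h) hx scalerN !scalerA -scalerBl /d.
    by congr (_ *: _); ring.
  have [u up uz] : exists2 u, u \notin p & u *: z = 0.
    apply: ann_eqN => [a|zp]; first exact: Kp.
    by have := gK z zK zp; rewrite gz eqxx.
  have cp i : (i < n)%N -> c i \in p.
    move=> ltin; have : u * d i \in p.
      apply: (IHn (fun i => u * d i)) => //.
      by rewrite -[RHS]uz scaler_sumr; apply: eq_bigr => j _; rewrite scalerA.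
    by rewrite !primeM (negPf up) (negPf (lamP _ _ ltin)) orbF.
  move=> i; rewrite ltnS leq_eqVlt => /predU1P[->|/cp //].
  have [_ <- _] := xP n; rewrite -cx big_ord_recr /= big1 ?add0r // => j _.
  by have [xK _ _] := xP j; apply: Kp => //; exact: cp.
have [n [c xn]] := noetherian_seq N_noeth x.
(* Moving [x n] to the other side gives a relation with coefficient [-1] at [n], which is not in
   [p]. *)
have := indep n.+1 (fun i => if (i < n)%N then c i else -1) _ n (ltnSn n).
rewrite ltnn primeNr (negPf (prime_proper p)) => contra.
suff : false by []; apply: contra.
rewrite big_ord_recr /= ltnn scaleN1r; apply/eqP; rewrite subr_eq0.
by apply/eqP; rewrite [RHS]xn; apply: eq_bigr => i _; rewrite ltn_ord.
Qed.

Variable F : set {linear N -> M}.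
Hypothesis F_submod : hom_submodule F.

Lemma perturb_injective (a : R) (K : {pred N}) (g h : {linear N -> M}) :
  a \notin p -> submod_closed K ->
  (forall y b, y \in K -> b \in p -> b *: y = 0) ->
  (forall y, y \in K -> ann_eq p y -> g y != 0) -> F g -> F h ->
  exists2 e, F e & forall y, y \in K -> ann_eq p y -> h y + a *: e y != 0.
Proof.
have [F0 Flin] := F_submod; move=> ap Ks Kp gK Fg Fh.
(* If [a] is invertible modulo [p] then [h] can be changed into [g] on [K];
   otherwise the powers of [a] are pairwise distinct modulo [p]. *)
have [[c ca]|noc] := pselect (exists c, 1 - a * c \in p).
  have Fe := Flin c _ _ (Flin (-1) _ _ Fh Fg) F0.
  eexists; first exact: Fe; move=> y yK yp /=.
  suff -> : h y + a *: (c *: (-1 *: h y + g y) + 0) = g y by exact: gK.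
  have -> : h y + a *: (c *: (-1 *: h y + g y) + 0) =
      g y + (1 - a * c) *: (h y - g y).
    have -> : -1 *: h y + g y = - (h y - g y).
      by rewrite scaleN1r opprB addrC.
    by rewrite addr0 scalerA scalerN scalerBl scale1r addrA [g y + _]addrC subrK.
  by rewrite scalerBr -(linearZ_LR h) -(linearZ_LR g) Kp // !linear0 !addr0.
(* The exponents start at 1, so that the scalar found is a multiple of [a], as the form [a *: e] of
   the correction requires. *)
have lamP i j : (i < j)%N -> a ^+ j.+1 - a ^+ i.+1 \notin p.
  move=> ltij; have -> : a ^+ j.+1 - a ^+ i.+1 =
      a ^+ i.+1 * - (1 - a * a ^+ (j - i).-1).
    rewrite -exprS prednK ?subn_gt0 // opprB mulrBr mulr1 -exprD.
    by rewrite addSn subnKC // ltnW.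
  rewrite primeM primeNr negb_or primeX //; apply/negP => ap'.
  by apply: noc; exists (a ^+ (j - i).-1).
have [n nP] := pencil_injective h Ks Kp gK lamP.
exists (a ^+ n \*: g \+ \0); first exact: Flin.
by move=> y yK yp /=; rewrite addr0 scalerA -exprS nP.
Qed.

Lemma perturb_column (a : R) (T : nat) (g h : nat -> {linear N -> M}) :
  a \notin p -> (forall i, F (g i)) -> (forall i, F (h i)) ->
  (forall y, ann_eq p y -> exists2 i, (i < T)%N & g i y != 0) ->
  exists f : nat -> {linear N -> M}, [/\ forall i, F (f i),
    forall i, exists e : {linear N -> M}, forall y, f i y = h i y + a *: e y &
    forall y, ann_eq p y -> exists2 i, (i < T)%N & f i y != 0].
Proof.
have [F0 Flin] := F_submod; move=> ap Fg Fh gP.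
(* The columns of [g] are exchanged one at a time for those of [f]. *)
pose mix k (f : nat -> {linear N -> M}) i := if (i < k)%N then f i else g i.
suff /(_ T (leqnn T))[f [Ff fh fP]] : forall k, (k <= T)%N ->
    exists f : nat -> {linear N -> M}, [/\ forall i, F (f i),
      forall i, exists e : {linear N -> M}, forall y, f i y = h i y + a *: e y &
      forall y, ann_eq p y -> exists2 i, (i < T)%N & mix k f i y != 0].
  exists f; split=> // y /fP[i iT]; rewrite /mix iT; by exists i.
elim=> [_|k IHk kT].
  by exists h; split=> // i; exists \0 => y; rewrite /= scaler0 addr0.
have [f [Ff fh fP]] := IHk (ltnW kT).
(* On [K] all columns other than the [k]-th vanish, so [g k] alone must be nonzero on the elements
   of [K] with annihilator [p]. *)
pose K := [pred y : N | `[< (forall b, b \in p -> b *: y = 0) /\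
  forall i, (i < T)%N -> i != k -> mix k f i y = 0 >]].
have Ks : submod_closed K.
  split=> [|c u w]; rewrite !inE.
    by split=> [b _|i _ _]; rewrite ?scaler0 ?linear0.
  move=> [up uk] [wp wk]; split=> [b bp|i iT ik].
    by rewrite scalerDr scalerC up // wp // scaler0 addr0.
  by rewrite linearP uk // wk // scaler0 addr0.
have [e Fe eP] : exists2 e, F e &
    forall y, y \in K -> ann_eq p y -> h k y + a *: e y != 0.
  apply: (perturb_injective (g := g k)) => // y.
    by move=> b; rewrite inE => -[yp _]; exact: yp.
  rewrite inE => -[_ yk] /fP[i iT]; have [->|ik] := eqVneq i k.
    by rewrite /mix ltnn.
  by rewrite yk ?eqxx.
exists (fun i =>
  if i == k then (a \*: e \+ h k : {linear N -> M}) else f i); split.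
- by move=> i; case: ifP => _ //; exact: Flin.
- move=> i; case: ifP => [/eqP->|_]; last exact: fh.
  by exists e => y; rewrite /= addrC.
move=> y yp; apply: contrapT => noi.
have yi i : (i < T)%N -> i != k -> mix k f i y = 0.
  move=> iT ik; apply/eqP; apply: contrapT => /negP fi; apply: noi.
  exists i => //; by move: fi; rewrite /mix (ltnS i k) (leq_eqVlt i k) (negPf ik).
apply: noi; exists k => //; rewrite /mix ltnSn eqxx /= addrC; apply: eP => //.
by rewrite inE; split=> // b bp; apply/eqP; rewrite yp.
Qed.

End Perturbation.

(** * From separation at each associated prime to injectivity after localization *)

Section Globalization.
Variables (R : comPzRingType) (N M : lmodType R).
Hypothesis N_noeth : noetherian N.
Variable F : set {linear N -> M}.
Hypothesis F_submod : hom_submodule F.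
Variable t : primeIdeal R -> nat.

(** Counting only the first [t p] maps at [p] is what lets one family serve every [S] with its own
    number of columns. *)
Definition separates (h : nat -> {linear N -> M}) (p : primeIdeal R) :=
  forall y, ann_eq p y -> exists2 i, (i < t p)%N & h i y != 0.

(** Induction removing a minimal prime [p]: adding multiples of an [a] that
    lies in all the other primes does not change the maps on the elements that
    these primes annihilate, and some such [a] is not in [p]. *)
Lemma exists_separating (s : seq (primeIdeal R)) :
  (forall p, p \in s -> exists2 g, forall i, F (g i) & separates g p) ->
  exists2 h, forall i, F (h i) & forall p, p \in s -> separates h p.
Proof.
have [n] := ubnP (size s); elim: n s => // n IHn s sn sP.
have [->|s0] := eqVneq s [::].
  by exists (fun=> \0) => // i; have [] := F_submod.
have [p ps pmin] := minimal_prime s0.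
have [|q|h Fh hP] := IHn [seq q <- s | q != p].
- rewrite -ltnS; apply: leq_trans sn; rewrite ltnS size_filter.
  rewrite -[ltnRHS](count_predC (pred1 p)) -[ltnLHS]add0n.
  by rewrite ltn_add2r -has_count has_pred1.
- by rewrite mem_filter => /andP[_]; exact: sP.
have [q|a ap aP] := @prime_avoid _ p [seq q <- s | q != p].
  by rewrite mem_filter => /andP[/eqP qp qs] /pmin; auto.
have [g Fg gP] := sP p ps.
have [f [Ff fh fP]] := perturb_column N_noeth F_submod ap Fg Fh gP.
exists f => // q qs; have [->//|qp] := eqVneq q p.
have qs' : q \in [seq q <- s | q != p] by rewrite mem_filter qp.
move=> y yq; have [i it hi] := hP q qs' y yq; exists i => //.
have [e ->] := fh i; rewrite -linearZ_LR.
by move/eqP: (yq a); rewrite aP // => ->; rewrite linear0 addr0.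
Qed.

(** Clearing denominators turns the local columns into maps in [F]. A common zero [y] with
    annihilator [p] would give a nonzero fraction [y / 1] in the kernel of an injective map. *)
Lemma cog_separating (p : primeIdeal R) :
  (cog (lochom (primeC p) F) <= (t p)%:Z%:E)%E ->
  exists2 g, forall i, F (g i) & separates g p.
Proof.
rewrite /cog /enat_inf; case: pselect => // ex.
case: ex_minnP => T /asboolP[/= f [Ff finj]] _.
rewrite lee_fin lez_nat => Tt.
have /choice[g gP] (j : 'I_T) : exists g, F g /\ exists s, forall z,
    f j z = rfrac 1 s *: locmap (primeC p) g z.
  by have [g [s [Fg gs]]] := Ff j; exists g; split=> //; exists s.
(* The [T] columns are padded with zero maps, as [T] may be smaller than [t p]. *)
exists (fun i => if insub i is Some j then g j else \0).
  move=> i; case: insubP => [j _ _|_]; first by have [] := gP j.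
  by have [] := F_submod.
move=> y yp; apply: contrapT => noi.
have gy j : g j y = 0.
  apply/eqP; apply: contrapT => /negP gj; apply: noi; exists j.
    exact: leq_trans Tt.
  by rewrite valK.
have : locfrac y (denom1 (primeC p)) = 0.
  apply: finj; apply/ffunP => j; rewrite !ffunE linear0.
  have [_ [s ->]] := gP j; rewrite locmapE gy locfracZ.
  by apply: locfrac_ext; rewrite !scaler0.
move/locfrac_eq => [u up] /=; rewrite !scale1r scaler0 => /eqP.
by rewrite yp; apply/negP.
Qed.

Lemma finite_Ass : finite_set (Ass N).
Proof.
by apply: sub_finite_set (finite_ann_eq N_noeth) => p /AssP; exact.
Qed.

Lemma max_ass_ge (S : mulrClosed R) (p : primeIdeal R) :
  Ass N p -> (forall a, a \in p -> a \notin S) -> (t p <= max_ass N t S)%N.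
Proof.
move=> Np pS; rewrite /max_ass.
set A := [set p | _ ].
(* Finiteness makes the big operator a genuine maximum instead of its default value. *)
have finA : finite_set A by apply: sub_finite_set finite_Ass => q [].
rewrite fsbig_finite //=; apply: leq_bigmax_seq => //.
by rewrite in_fset_set // inE.
Qed.

(** Otherwise some [a *: x] has as annihilator an associated prime [p] disjoint from [S]; one of the
    first [t p] maps is nonzero there, hence nonzero at [x], and [t p] is at most the maximum for
    [S]. *)
Lemma separates_kernel (h : nat -> {linear N -> M}) (S : mulrClosed R)
    (x : N) :
  (forall p, Ass N p -> separates h p) ->
  (forall i, (i < max_ass N t S)%N -> h i x = 0) ->
  exists2 s, s \in S & s *: x = 0.
Proof.
move=> hP hx; apply: contrapT => nos.
have Sx s : s \in S -> s *: x != 0.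
  by move=> sS; apply/eqP => sx; apply: nos; exists s.
have [p [a [pax pS]]] := exists_ann_eq N_noeth Sx.
have Np : Ass N p by apply/AssP => //; exists (a *: x).
have [i it] := hP p Np _ pax.
by rewrite linearZ_LR hx ?scaler0 ?eqxx // (leq_trans it) ?max_ass_ge.
Qed.

End Globalization.

Theorem theorem4p4 (R : comPzRingType) (M N : lmodType R)
    (N_neq0 : exists x : N, x != 0) (N_noeth : noetherian N)
    (F : set {linear N -> M}) (F_submod : hom_submodule F)
    (t : primeIdeal R -> nat)
    (cog_fin : forall p, Ass N p -> cog (lochom (primeC p) F) \is a fin_num)
    (cog_le_t : forall p, Ass N p ->
       (cog (lochom (primeC p) F) <= (t p)%:Z%:E)%E) :
  let v := max_ass N t in
  exists h : nat -> {linear N -> M},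
    [/\ forall i, (i < v mul_one)%N -> F (h i),
        forall S : mulrClosed R,
          (forall a, a \in S -> ~ annihilator N a) ->
          injective (locmap S (colmap (fun i : 'I_(v S) => h i)))
      & injective (colmap (fun i : 'I_(v mul_one) => h i))].
Proof.
move=> v.
have /finite_seqP[s sE] := finite_Ass N_noeth.
have Ns p : (p \in s) = (p \in Ass N).
  by rewrite sE; apply/idP/idP; rewrite inE.
have [p ps|h Fh hP] := exists_separating N_noeth F_submod (t := t) (s := s).
  apply: cog_separating => //; apply: cog_le_t.
  by move: ps; rewrite Ns inE.
have {}hP p : Ass N p -> separates t h p.
  by move=> Np; apply: hP; rewrite Ns inE.
exists h; split=> // [S _|].
  apply: raddf_inj; elim/locfracW=> x r; rewrite [X in X = _]locmapE.
  move=> /locfrac_eq[u uS] /=; rewrite scale1r !scaler0 => ux.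
  (* A vanishing image fraction only says that the columns vanish at [u *: x] for some [u] in
     [S]. *)
  have [i iv|w wS wux] := separates_kernel N_noeth (x := u *: x) (S := S) hP.
    by rewrite linearZ_LR; have /ffunP/(_ (Ordinal iv)) := ux; rewrite !ffunE.
  apply/locfrac_eq; exists (w * u); first exact: rpredM.
  by rewrite /= scale1r !scaler0 -scalerA.
apply: raddf_inj => x hx.
have [i iv|w] := separates_kernel N_noeth (x := x) (S := mul_one) hP.
  by have /ffunP/(_ (Ordinal iv)) := hx; rewrite !ffunE.
by rewrite inE => /eqP->; rewrite scale1r.
Qed.
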